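(* Let $L=(L_t)_{t\ge 0}$ be a real-valued Lévy process satisfying the sector condition, such that $L_t$ is absolutely continuous for every $t>0$. Assume that $L$ has Blumenthal--Getoor index $\beta\in[0,2]$ and that $\mathbb{E}[|L_1|^p]<\infty$ for some $p>0$. Then $$\limsup_{t\to0^+}\frac{h(L_t)}{\log(1/t)}\le-\frac1\beta,$$ with the convention $1/0=\infty$. In particular, if $\beta=0$, then $$\lim_{t\to0^+}\frac{h(L_t)}{\log(1/t)}=-\infty.$$
   Context: A Lévy process $L$ has $L_0=0$ a.s., stationary independent increments, and a.s. càdlàg paths. Its characteristic exponent $\Psi:\mathbb{R}\to\mathbb{C}$ is the continuous function with $\mathbb{E}[e^{i\xi L_t}]=\exp(t\Psi(\xi))$ for all $t\ge0$, $\xi\in\mathbb{R}$. Sector condition: there is a constant $C>0$ such that $|\Im\Psi(\xi)|\le C|\Re\Psi(\xi)|$ for all $\xi\in\mathbb{R}$. Blumenthal--Getoor index: $\beta=\inf\{p>0:\ |\Psi(\xi)|/|\xi|^p\to 0\text{ as }|\xi|\to\infty\}\in[0,2]$. For an absolutely continuous real random variable $X$ with density $p_X$, the differential entropy is $h(X)=-\int_{\mathbb{R}}p_X(x)\log p_X(x)\,dx$ (convention $0\log 0=0$), well-defined in $[-\infty,\infty]$ when the positive or the negative part of the integrand is integrable. Under the assumptions of the statement, $h(L_t)$ is well-defined in $[-\infty,\infty)$; the value $-\infty$ is allowed. $\log$ is the natural logarithm. *)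

(* Defs.v *)
From HB Require Import structures.
From mathcomp Require Import all_boot all_order all_algebra.
From mathcomp Require Import all_classical all_reals all_analysis.
From mathcomp Require Import measurable_realfun.
From mathcomp Require Import complex.

Set Implicit Arguments.
Unset Strict Implicit.
Unset Printing Implicit Defensive.

Import Order.TTheory GRing.Theory Num.Theory.
Import numFieldNormedType.Exports.

Local Open Scope classical_set_scope.
Local Open Scope ring_scope.

Definition cexp (R : realType) (z : R[i]) : R[i] :=
  (expR (complex.Re z) * cos (complex.Im z)
    +i* (expR (complex.Re z) * sin (complex.Im z)))%C.

Section levy_process.
Context d (T : measurableType d) (R : realType) (P : probability T R).
Implicit Types (X : {RV P >-> R}) (L : R -> {RV P >-> R}) (Psi : R -> R[i]).

(* The product rule for subfamilies is the case where some of the B i are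
   the full set. *)
Definition mutually_independent (I : finType) (X : I -> T -> R) : Prop :=
  forall B : I -> set R, (forall i, measurable (B i)) ->
    P (\bigcap_i (X i @^-1` B i)) = (\prod_i P (X i @^-1` B i))%E.

(* Processes are indexed by the whole of R; only the times t >= 0 matter. *)
Definition independent_increments L : Prop :=
  forall (n : nat) (t : nat -> R), 0 <= t 0%N -> (forall i, t i < t i.+1) ->
    mutually_independent (fun (i : 'I_n) (w : T) => L (t i.+1) w - L (t i) w).

Definition stationary_increments L : Prop :=
  forall s t : R, 0 <= s -> 0 <= t -> forall B : set R, measurable B ->
    P [set w | B (L (s + t) w - L s w)] = P [set w | B (L t w - L 0 w)].

Definition cadlag (x : R -> R) : Prop :=
  (forall t : R, 0 <= t -> x s @[s --> t^'+] --> x t) /\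
  (forall t : R, 0 < t -> exists l : R, x s @[s --> t^'-] --> l).

Definition levy_process L : Prop :=
  [/\ {ae P, forall w, L 0 w = 0},
      independent_increments L,
      stationary_increments L &
      {ae P, forall w, cadlag (fun t => L t w)}].

Definition char_fun X (xi : R) : R[i] :=
  (fine 'E_P[fun w => cos (xi * X w)]
    +i* fine 'E_P[fun w => sin (xi * X w)])%C.

Definition is_char_exponent L Psi : Prop :=
  continuous (Psi : R -> R[i]^o) /\
  forall t xi : R, 0 <= t -> char_fun (L t) xi = cexp (t%:C%C * Psi xi).

Definition absolutely_continuous X : Prop :=
  distribution P X `<< @lebesgue_measure R.

Definition is_density X (p : R -> R) : Prop :=
  [/\ measurable_fun setT p, (forall x, 0 <= p x) &
      forall B : set R, measurable B ->
        distribution P X B = (\int[@lebesgue_measure R]_(x in B) (p x)%:E)%E].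

Lemma absolutely_continuous_density X :
  absolutely_continuous X -> exists p, is_density X p.
Proof.
move=> Xac.
have mX : @measurable_fun _ _ T (measurableTypeR R) setT X.
  exact: (@measurable_funPT _ _ _ _ X).
pose mX' := isMeasurableFun.Build _ _ T (measurableTypeR R) X mX.
pose Y : {mfun T >-> measurableTypeR R} := HB.pack (X : T -> measurableTypeR R) mX'.
have [f [f0 ffin fint fE]] := @radon_nikodym_sigma_finite _ _ R
  (@lebesgue_measure R) (distribution P Y) Xac.
exists (fine \o f); split.
- have /measurable_int mf := fint.
  exact: measurableT_comp (fine_measurable (@measurableT _ _)) mf.
- by move=> x; apply: fine_ge0.
- move=> B mB; rewrite -[LHS]/(distribution P Y B) fE//.
  by apply: eq_integral => x _ /=; rewrite fineK.
Qed.

Definition density X : R -> R := xget (fun=> 0) (is_density X).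

(* ln 0 = 0 in the library, hence 0 * ln 0 = 0. The integral of f is
   the integral of f^\+ minus that of f^\-, with +oo - +oo = -oo: in the
   ill-defined case the value below is +oo, so an upper bound on the entropy
   that is < +oo entails that it is well-defined. *)
Definition differential_entropy X : \bar R :=
  (- \int[@lebesgue_measure R]_x (density X x * ln (density X x))%:E)%E.

End levy_process.

Definition sector_condition (R : realType) (Psi : R -> R[i]) : Prop :=
  exists2 C : R, 0 < C &
    forall xi, `|complex.Im (Psi xi)| <= C * `|complex.Re (Psi xi)|.

(* |xi| --> oo is rendered as both xi --> +oo and xi --> -oo. *)
Definition blumenthal_getoor_index (R : realType) (Psi : R -> R[i]) : \bar R :=
  ereal_inf [set p%:E | p in [set p : R | [/\ 0 < p,
    (ComplexField.Normc.normc (Psi xi) / `|xi| `^ p @[xi --> +oo] --> (0 : R))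
    & (ComplexField.Normc.normc (Psi xi) / `|xi| `^ p
        @[xi --> -oo] --> (0 : R))]]].

(* Main.v *)
(* By Gibbs' inequality against the Cauchy density of scale s,
     h(X) <= ln s + pi + E ln (1 + (X / s) ^ 2).
   For q > beta take s = t ^ (1 / q): it remains to see that
   E ln (1 + |L_t| / s) = o(ln (1 / t)). On {|L_t| < r}, with r small and fixed,
   the logarithm is dominated by a weighted sum of 1 - cos (L_t / (s 2 ^ j)),
   whose expectations are at most 2 t |Psi (1 / (s 2 ^ j))| <= 2 * 2 ^ (- j q);
   the weights 2 ^ (j q / 2) make the sum bounded. On {|L_t| >= r} it is at most
   ln (1 / s) + ln (1 + |L_t|), where P (|L_t| >= r) tends to 0 by right
   continuity at 0, and E ln (1 + |L_t|) is bounded for small t since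
   L_1 - L_t is independent of L_t and tight. *)

Require Import Defs.
From HB Require Import structures.
From mathcomp Require Import all_boot all_order all_algebra.
From mathcomp Require Import all_classical all_reals all_analysis.
From mathcomp Require Import measurable_realfun.
From mathcomp Require Import complex.
From mathcomp Require Import ring lra.

Set Implicit Arguments.
Unset Strict Implicit.
Unset Printing Implicit Defensive.

Import Order.TTheory GRing.Theory Num.Theory.
Import numFieldNormedType.Exports.

Local Open Scope classical_set_scope.
Local Open Scope ring_scope.

(** * Elementary inequalities for logarithm and cosine *)

(** The left-hand side is the tangent at [y] of the convex function x ln x; this is the pointwise
    form of Gibbs' inequality. At x = 0 it reduces to -y <= 0. *)
Lemma entropy_tangent (R : realType) (x y : R) : 0 <= x -> 0 < y ->
  x * ln y + x - y <= x * ln x.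
Proof.
rewrite le_eqVlt => /predU1P[<- y0|x0 y0]; first by rewrite !mul0r; lra.
have /(@le_ln1Dx R) : -1 < y / x - 1 by have := divr_gt0 y0 x0; lra.
rewrite addrC subrK ln_div ?posrE// => /(ler_wpM2l (ltW x0)).
rewrite mulrBr mulrBr mulrCA divff ?gt_eqF// !mulr1; lra.
Qed.

(** From ln z <= z at z = a ^ n. It turns a bound linear in the dyadic index into a geometric
    one. *)
Lemma natr_ln_le_exp (R : realType) (a : R) (n : nat) :
  0 < a -> n%:R * ln a <= a ^+ n.
Proof.
move=> a0; rewrite mulr_natl -lnXn//.
by rewrite ltW// ln_sublinear// exprn_gt0.
Qed.

(** Cosine decreases on [0, pi], which contains [1, 2]. *)
Lemma one_sub_cos_ge (R : realType) (x : R) : 1 <= x <= 2 ->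
  1 - cos 1 <= 1 - cos x.
Proof.
move=> /andP[x1 x2]; rewrite lerD2l lerN2.
have pi2 := @pi_ge2 R.
move: x1; rewrite le_eqVlt => /predU1P[->//|x1]; apply: ltW.
by rewrite ltr_cos ?in_itv/=; lra.
Qed.

Lemma cos1_lt1 (R : realType) : cos 1 < 1 :> R.
Proof.
have pi2 := @pi_ge2 R.
by rewrite -[ltRHS]cos0 ltr_cos ?in_itv/=; lra.
Qed.

Lemma cos_norm (R : realType) (x : R) : cos `|x| = cos x.
Proof. by case: (ger0P x) => // _; rewrite cosN. Qed.

(* When 2 ^ j <= |y| / s < 2 ^ (j + 1), the number |y| / (s 2 ^ j) lies in
   [1, 2], so the j-th summand alone dominates the logarithm. *)
Lemma ln_le_dyadic_cos (R : realType) (a s y : R) (N : nat) :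
  1 < a -> 0 < s -> `|y| < s * 2 ^+ N ->
  ln (1 + `|y| / s) <= ln 2 + ln 2 / ln a * a ^+ 2 / (1 - cos 1) *
    \sum_(j < N) a ^+ j * (1 - cos ((s * 2 ^+ j)^-1 * y)).
Proof.
move=> a1 s0; have a0 : 0 < a by lra.
have lna : 0 < ln a by exact: ln_gt0.
have ln2 : 0 < ln 2 :> R by apply: ln_gt0; lra.
have c1 := @cos1_lt1 R.
set C := _ / _ * _ / _.
have C0 : 0 < C by rewrite !(mulr_gt0, divr_gt0, invr_gt0, exprn_gt0)//; lra.
have ys : 0 <= `|y| / s by rewrite divr_ge0// ltW.
have t0 j : 0 <= a ^+ j * (1 - cos ((s * 2 ^+ j)^-1 * y)).
  by rewrite mulr_ge0 ?exprn_ge0 ?(ltW a0)// subr_ge0 cos_le1.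
elim: N => [|N IH] yN.
  rewrite big_ord0 mulr0 addr0; move: yN; rewrite expr0 mulr1 => yN.
  by rewrite ler_ln ?posrE//; [rewrite (_ : 2 = 1 + 1)// lerD2l ler_pdivrMr// mul1r ltW|lra].
have [/IH {}IH|yN'] := ltP `|y| (s * 2 ^+ N).
  rewrite (le_trans IH)// lerD2l ler_wpM2l ?(ltW C0)// big_ord_recr/= lerDl.
  exact: t0.
have p2 : 0 < 2 ^+ N :> R by exact: exprn_gt0.
have p2' : 1 <= 2 ^+ N :> R by apply: exprn_ege1; lra.
rewrite big_ord_recr/= mulrDr.
have S0 : 0 <= C * \sum_(i < N) a ^+ i * (1 - cos ((s * 2 ^+ i)^-1 * y)).
  by apply: mulr_ge0; [exact: ltW|apply: sumr_ge0 => i _; exact: t0].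
suff : ln (1 + `|y| / s) <= C * (a ^+ N * (1 - cos ((s * 2 ^+ N)^-1 * y))) by lra.
have z1 : 1 <= (s * 2 ^+ N)^-1 * `|y| <= 2.
  rewrite mulrC ler_pdivlMr ?mulr_gt0// mul1r yN'/= ler_pdivrMr ?mulr_gt0//.
  by move: yN; rewrite exprS; nra.
have cosy : 1 - cos 1 <= 1 - cos ((s * 2 ^+ N)^-1 * y).
  rewrite -(cos_norm (_ * y)) normrM (gtr0_norm (_ : 0 < (s * 2 ^+ N)^-1)).
    exact: one_sub_cos_ge.
  by rewrite invr_gt0 mulr_gt0.
(* Here |y| / s < 2 ^ (N + 1), and 1 + 2 ^ (N + 1) <= 2 ^ (N + 2). Then (N + 2) ln a <= a ^ (N + 2)
   produces the factors [a ^+ 2] and ln 2 / ln a of [C], while 1 - cos 1 is the least value of the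
   cosine factor. *)
have lnle : ln (1 + `|y| / s) <= N.+2%:R * ln 2.
  rewrite mulr_natl -lnXn// ler_ln ?posrE ?exprn_gt0//; last by lra.
  have : `|y| / s <= 2 ^+ N.+1.
    by rewrite ler_pdivrMr// mulrC ltW.
  rewrite !exprS; lra.
apply: (le_trans lnle).
have -> : C * (a ^+ N * (1 - cos ((s * 2 ^+ N)^-1 * y))) =
   (ln 2 / ln a) * a ^+ N.+2 * ((1 - cos ((s * 2 ^+ N)^-1 * y)) / (1 - cos 1)).
  by rewrite /C !exprS; field; rewrite !gt_eqF//; lra.
apply: (@le_trans _ _ (ln 2 / ln a * a ^+ N.+2)).
  rewrite mulrAC ler_pdivlMr// mulrAC [leRHS]mulrC ler_wpM2r ?(ltW ln2)//.
  by rewrite natr_ln_le_exp.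
apply: ler_peMr; last by rewrite ler_pdivlMr ?mul1r//; lra.
by rewrite mulr_ge0 ?exprn_ge0 ?divr_ge0// ltW.
Qed.

Lemma ln_sqr_le (R : realType) (y : R) : ln (1 + y ^+ 2) <= 2 * ln (1 + `|y|).
Proof.
have y0 := normr_ge0 y.
rewrite mulr_natl -lnXn; last by lra.
rewrite -[y ^+ 2]real_normK ?num_real// ler_ln ?posrE; nra.
Qed.

Lemma ln1D_scale (R : realType) (s y : R) : 0 < s <= 1 -> 0 <= y ->
  ln (1 + y / s) <= ln s^-1 + ln (1 + y).
Proof.
move=> /andP[s0 s1] y0.
have ys : 0 <= y / s by rewrite divr_ge0// ltW.
rewrite -lnM ?posrE ?invr_gt0//; last by lra.
rewrite ler_ln ?posrE ?mulr_gt0 ?invr_gt0//; try lra.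
by rewrite mulrDr mulr1 mulrC lerD2r invf_ge1.
Qed.

Lemma ln1D_subadd (R : realType) (x y : R) :
  ln (1 + `|x|) <= ln (1 + `|y|) + ln (1 + `|y - x|).
Proof.
have := normr_ge0 x; have := normr_ge0 y; have := normr_ge0 (y - x).
have : `|x| <= `|y| + `|y - x|.
  by rewrite -[in leLHS](subKr y x) (le_trans (ler_normB _ _)).
by move=> xyz z0 y0 x0; rewrite -lnM ?posrE ?ler_ln ?posrE; nra.
Qed.

(** For |x| > 1, 1 + |x| <= 2 |x|, and ln z <= z at z = |x| ^ p bounds ln |x|. Thus any power moment
    controls the logarithmic one. *)
Lemma ln1D_le_powR (R : realType) (p x : R) : 0 < p ->
  ln (1 + `|x|) <= ln 2 + `|x| `^ p / p.
Proof.
move=> p0.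
have x0 := normr_ge0 x.
have : 0 < ln 2 :> R by apply: ln_gt0; lra.
have [x1|x1] := leP `|x| 1.
  have : ln (1 + `|x|) <= ln 2 by rewrite ler_ln ?posrE; lra.
  have : 0 <= `|x| `^ p / p by rewrite divr_ge0 ?powR_ge0 ?ltW.
  by lra.
have : ln (1 + `|x|) <= ln 2 + ln `|x|.
  by rewrite -lnM ?posrE ?ler_ln ?posrE; lra.
suff : ln `|x| <= `|x| `^ p / p by lra.
rewrite ler_pdivlMr// mulrC -ln_powR ltW// ln_sublinear// powR_gt0; lra.
Qed.

(** * Entropy bound by comparison with a Cauchy density *)

(* No integrability is needed: \bar R has +oo - +oo = -oo, and this
   subtraction is monotone. *)
Lemma le_integral_extended d (T : measurableType d) (R : realType)
    (mu : {measure set T -> \bar R}) (f g : T -> \bar R) :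
  measurable_fun setT f -> measurable_fun setT g ->
  (forall x, f x <= g x)%E -> (\int[mu]_x f x <= \int[mu]_x g x)%E.
Proof.
move=> mf mg fg; rewrite (integralE _ _ f) (integralE _ _ g); apply: leeB.
- apply: (@ge0_le_integral _ _ _ mu setT measurableT f^\+%E g^\+%E).
  + by move=> x _; exact: funepos_ge0.
  + exact: measurable_funepos.
  + exact: measurable_funepos.
  + by move=> x _; apply: (@funepos_le _ _ setT) => [y _|]; rewrite ?inE.
- apply: (@ge0_le_integral _ _ _ mu setT measurableT g^\-%E f^\-%E).
  + by move=> x _; exact: funeneg_ge0.
  + exact: measurable_funeneg.
  + exact: measurable_funeneg.
  + by move=> x _; apply: (@funeneg_le _ _ setT) => [y _|]; rewrite ?inE.
Qed.

(** The integrand is pi times the Cauchy density of scale [s]. It is even, and atan (x / s) is an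
    antiderivative on the half-line. *)
Lemma integral_cauchy (R : realType) (s : R) : 0 < s ->
  (\int[@lebesgue_measure R]_x (s^-1 * (1 + (x / s) ^+ 2)^-1)%:E = (pi : R)%:E)%E.
Proof.
move=> s0; pose f (x : R) := s^-1 * (1 + (x / s) ^+ 2)^-1.
have V0 : 0 < s^-1 by rewrite invr_gt0.
have D0 (x : R) : 0 < 1 + (x / s) ^+ 2.
  by have := sqr_ge0 (x / s); lra.
have f0 x : 0 <= f x by rewrite /f mulr_ge0 ?invr_ge0// ltW.
have cf : continuous f.
  move=> x; apply: cvgM; first exact: cvg_cst.
  apply: cvgV; first by rewrite gt_eqF.
  apply: cvgD; first exact: cvg_cst.
  by apply: (@cvgM _ _ _ _ (fun x => x / s) (fun x => x / s)); exact: mulrr_continuous.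
rewrite (ge0_symfun_integralT f0 cf); last first.
  by move=> x; rewrite /f /= mulNr sqrrN.
have -> : [set x : R | 0 <= x] = `[0, +oo[%classic.
  by apply/seteqP; split=> x /=; rewrite in_itv/= andbT.
pose F (x : R) := atan (x / s).
have dF (x : R) : is_derive x (1 : R) F (f x).
  rewrite /F /f mulrC; apply: (@is_derive1_comp _ atan (fun x => x / s)).
  have -> : (fun x => x / s) = ( *%R s^-1) by apply/funext => z; rewrite mulrC.
  by apply: is_derive_eq; rewrite /GRing.scale/= mulr1.
rewrite (@ge0_continuous_FTC2y _ f F 0 (pi / 2)).
- by rewrite /F mul0r atan0 sube0 -EFinM mulrC divfK.
- by move=> x _.
- by apply: continuous_subspaceT.
- apply: (@cvg_comp _ _ _ (fun x => x / s) atan _ +oo%R) => //.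
    exact: gt0_cvgMly.
  exact: cvgy_atan.
- by move=> x _; apply: ex_derive.
- apply: cvg_at_right_filter; apply: differentiable_continuous.
  by apply/derivable1_diffP; exact: ex_derive.
- by move=> x _; rewrite derive1E; apply: derive_val.
Qed.

(** The Radon-Nikodym derivative of the law of [X] obeys the change of variables, and [p] agrees
    with it almost everywhere because both have the same integral over every measurable set. *)
Lemma integral_density d (T : measurableType d) (R : realType)
    (P : probability T R) (X : {RV P >-> R}) (p u : R -> R) :
  is_density X p -> measurable_fun setT u -> (forall x, 0 <= u x) ->
  (\int[@lebesgue_measure R]_x (p x * u x)%:E = \int[P]_w (u (X w))%:E)%E.
Proof.
move=> [mp p0 pE] mu u0.
have mX : @measurable_fun _ _ T (measurableTypeR R) setT X.
  exact: (@measurable_funPT _ _ _ _ X).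
pose mX' := isMeasurableFun.Build _ _ T (measurableTypeR R) X mX.
pose Y : {mfun T >-> measurableTypeR R} := HB.pack (X : T -> measurableTypeR R) mX'.
have Yac : distribution P Y `<< @lebesgue_measure R.
  apply/null_content_dominatesP => A mA A0.
  rewrite -[LHS]/(distribution P X A) pE//.
  apply: null_set_integral => //.
  exact/measurable_EFinP/measurable_funTS.
transitivity (\int[distribution P Y]_y (u y)%:E)%E; last first.
  rewrite (ge0_integral_distribution Y)//; exact/measurable_EFinP.
have mI := Radon_Nikodym_SigmaFinite.f_integrable Yac.
have mf := measurable_int _ mI.
have me : measurable_fun setT (EFin \o u) by exact/measurable_EFinP.
have mpe : measurable_fun setT (EFin \o p) by exact/measurable_EFinP.
rewrite -(@Radon_Nikodym_SigmaFinite.change_of_variables _ _ _ (distribution P Y) _ Yac)//.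
under eq_integral do rewrite mulrC EFinM.
apply: ae_eq_integral => //.
- exact: emeasurable_funM.
- exact: emeasurable_funM.
- apply: ae_eqe_mul2l; apply: ae_eq_sym; apply: integral_ae_eq => //.
  move=> E _ mE.
  by rewrite -Radon_Nikodym_SigmaFinite.f_integral// -pE.
Qed.

(** The comparison function [g] is the Cauchy density without its factor 1 / pi. Its mass is pi and
    that of [f] is 1, so the integrated tangent inequality contributes pi - 1, relaxed to pi. *)
Lemma differential_entropy_le d (T : measurableType d) (R : realType)
    (P : probability T R) (X : {RV P >-> R}) (s : R) :
  0 < s -> absolutely_continuous X ->
  (differential_entropy X <=
    (ln s + pi)%:E + \int[P]_w (ln (1 + (X w / s) ^+ 2))%:E)%E.
Proof.
move=> s0 /absolutely_continuous_density exf.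
have fX : is_density X (density X) by exact: xgetPex.
rewrite /differential_entropy; move: (density X) fX => f fX.
have [mf f0 fE] := fX.
pose D (x : R) := 1 + (x / s) ^+ 2.
pose u x := ln (D x).
pose g x := s^-1 * (D x)^-1.
have V0 : 0 < s^-1 by rewrite invr_gt0.
have D1 x : 1 <= D x by have := sqr_ge0 (x / s); rewrite /D; lra.
have D0 x : 0 < D x by have := D1 x; lra.
have u0 x : 0 <= u x by rewrite ln_ge0.
have g0 x : 0 < g x by rewrite mulr_gt0// invr_gt0.
have mD : measurable_fun setT D.
  apply: measurable_funD => //; apply: measurable_funX; exact: measurable_funM.
have mu : measurable_fun setT u by exact: measurableT_comp.
have lng x : ln (g x) = - ln s - u x.
  by rewrite lnM ?posrE ?invr_gt0// !lnV ?posrE.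
have mg : measurable_fun setT g.
  rewrite (_ : g = fun x => expR (- ln s - u x)).
    by apply: measurableT_comp => //; exact: measurable_funB.
  by apply/funext => x; rewrite -lng lnK ?posrE.
have intu := integral_density fX mu u0.
rewrite -/(u _).
have [Iy|Ifin] := eqVneq (\int[P]_w (u (X w))%:E)%E +oo%E.
  by rewrite Iy addey// leey.
have If : (\int[P]_w (u (X w))%:E \is a fin_num)%E.
  rewrite ge0_fin_numE; first by rewrite ltey.
  by apply: integral_ge0 => w _; rewrite lee_fin.
have intf : (\int[@lebesgue_measure R]_x (f x)%:E = 1)%E.
  by rewrite -fE// probability_setT.
have intg : (\int[@lebesgue_measure R]_x (g x)%:E = (pi:R)%:E)%E.
  exact: integral_cauchy.
have mfu : measurable_fun setT (fun x => f x * u x) by exact: measurable_funM.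
have ifu : (@lebesgue_measure R).-integrable setT (EFin \o (fun x => f x * u x)).
  apply/integrableP; split; first exact/measurable_EFinP.
  under eq_integral => x _ do rewrite /= ger0_norm ?mulr_ge0//.
  by rewrite intu ltey.
have if1 : (@lebesgue_measure R).-integrable setT (EFin \o f).
  apply/integrableP; split; first exact/measurable_EFinP.
  under eq_integral => x _ do rewrite /= ger0_norm//.
  by rewrite intf ltry.
have ig : (@lebesgue_measure R).-integrable setT (EFin \o g).
  apply/integrableP; split; first exact/measurable_EFinP.
  under eq_integral => x _ do rewrite /= gtr0_norm//.
  by rewrite intg ltry.
(* [k] is the tangent minorant f ln g + f - g of f ln f. Each of its terms is integrable, so its
   integral splits, although f ln f itself may fail to be integrable. *)
pose k x : \bar R := ((1 - ln s)%:E * (f x)%:E - ((f x * u x)%:E + (g x)%:E))%E.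
have Hk : (\int[@lebesgue_measure R]_x k x = (1 - ln s)%:E - (\int[P]_w (u (X w))%:E + pi%:E))%E.
  rewrite integralB//=; last 2 first.
  - exact: integrableZl.
  - exact: integrableD.
  by rewrite integralZl// integralD// intf mule1 intu intg.
rewrite leeNl.
apply: (@le_trans _ _ (\int[@lebesgue_measure R]_x k x)%E).
  rewrite Hk -(fineK If) -!EFinD -!EFinN lee_fin; lra.
apply: le_integral_extended.
- apply: emeasurable_funB; first by apply: emeasurable_funM => //; exact/measurable_EFinP.
  by apply: emeasurable_funD; exact/measurable_EFinP.
- apply/measurable_EFinP; apply: measurable_funM => //; exact: measurableT_comp.
move=> x; rewrite /k -EFinM -!EFinD lee_fin.
apply: le_trans (entropy_tangent (f0 x) (g0 x)); rewrite lng; lra.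
Qed.

(** * The characteristic exponent and the mean of 1 - cos *)

(** Mean value theorem with |sin| <= 1. At t Im Psi it gives a bound linear in t, of the same order
    as the one for the real part. *)
Lemma one_sub_cos_le (R : realType) (x : R) : 1 - cos x <= `|x|.
Proof.
rewrite -cos_norm -[X in X - _]cos0; move: `|x| (normr_ge0 x) => {}x x0.
have [c _] := @MVT_segment R cos (fun x => - sin x) 0 x x0
  (fun y _ => is_derive_cos y) (continuous_subspaceT (@continuous_cos R)).
have := sin_le1 c; rewrite subr0; nra.
Qed.

Lemma norm_Re_le_normc (R : realType) (z : R[i]) :
  `|complex.Re z| <= ComplexField.Normc.normc z.
Proof.
by case: z => a b /=; rewrite -sqrtr_sqr ler_wsqrtr// lerDl sqr_ge0.
Qed.

Lemma norm_Im_le_normc (R : realType) (z : R[i]) :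
  `|complex.Im z| <= ComplexField.Normc.normc z.
Proof.
by case: z => a b /=; rewrite -sqrtr_sqr ler_wsqrtr// lerDr sqr_ge0.
Qed.

Section char_exponent.
Context d (T : measurableType d) (R : realType) (P : probability T R).
Implicit Types X : {RV P >-> R}.

Lemma measurable_cosM X (xi : R) : measurable_fun setT (fun w => cos (xi * X w)).
Proof.
apply: (@measurableT_comp _ _ _ _ _ _ (@cos R) _ (fun w => xi * X w)).
  by apply: continuous_measurable_fun; exact: continuous_cos.
by apply: measurable_funM => //; exact: measurable_funPT.
Qed.

Lemma measurable_sinM X (xi : R) : measurable_fun setT (fun w => sin (xi * X w)).
Proof.
apply: (@measurableT_comp _ _ _ _ _ _ (@sin R) _ (fun w => xi * X w)).
  by apply: continuous_measurable_fun; exact: continuous_sin.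
by apply: measurable_funM => //; exact: measurable_funPT.
Qed.

Lemma integrable_bounded1 (f : T -> R) : measurable_fun setT f ->
  (forall w, `|f w| <= 1) -> P.-integrable setT (EFin \o f).
Proof.
move=> mf f1; apply: (@le_integrable _ _ _ P setT measurableT _ (cst 1%E)).
- exact/measurable_EFinP.
- by move=> w _ /=; rewrite normr1 lee_fin.
- exact: finite_measure_integrable_cst.
Qed.

Lemma norm_expectation_le1 (f : T -> R) : measurable_fun setT f ->
  (forall w, `|f w| <= 1) -> `|fine 'E_P[f]| <= 1.
Proof.
move=> mf f1; have fi := integrable_bounded1 mf f1.
rewrite unlock -lee_fin EFin_normr_Rintegral//.
apply: (le_trans (le_abse_integral _ _ _)) => //.
  exact/measurable_EFinP.
apply: (@le_trans _ _ (\int[P]_w (cst 1 w))%E).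
  apply: ge0_le_integral => //.
  - by apply: measurableT_comp => //; exact/measurable_EFinP.
  - by move=> w _; rewrite /= lee_fin.
by rewrite integral_cst// mul1e; exact: probability_le1.
Qed.

Section exponent.
Variables (L : R -> {RV P >-> R}) (Psi : R -> R[i]).
Hypothesis LPsi : is_char_exponent L Psi.

Lemma char_exponent_cos (t xi : R) : 0 <= t ->
  fine 'E_P[fun w => cos (xi * L t w)] =
  expR (t * complex.Re (Psi xi)) * cos (t * complex.Im (Psi xi)).
Proof.
move=> t0; have [_ /(_ t xi t0)] := LPsi.
rewrite /char_fun /cexp; case: (Psi xi) => a b [+ _].
by rewrite /= !mul0r subr0 addr0.
Qed.

Lemma char_exponent_sin (t xi : R) : 0 <= t ->
  fine 'E_P[fun w => sin (xi * L t w)] =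
  expR (t * complex.Re (Psi xi)) * sin (t * complex.Im (Psi xi)).
Proof.
move=> t0; have [_ /(_ t xi t0)] := LPsi.
rewrite /char_fun /cexp; case: (Psi xi) => a b [_].
by rewrite /= !mul0r subr0 addr0.
Qed.

(* |exp (t Psi)| ^ 2 <= 2 for all t >= 0. *)
Lemma char_exponent_Re_le0 (xi : R) : complex.Re (Psi xi) <= 0.
Proof.
rewrite leNgt; apply/negP; set a := complex.Re _ => a0.
(* At time 1 / a the characteristic function has modulus e, whose square is at least 4; but its two
   components are bounded by 1, so the square is at most 2. *)
have V0 : 0 <= a^-1 by rewrite invr_ge0 ltW.
have := norm_expectation_le1 (measurable_cosM (L a^-1) xi) (fun w => cos_max _).
have := norm_expectation_le1 (measurable_sinM (L a^-1) xi) (fun w => sin_max _).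
rewrite char_exponent_cos// char_exponent_sin// -/a mulVf ?gt_eqF//.
have e2 : 2 <= expR 1 :> R by have := expR_ge1Dx (1 : R); lra.
have := cos2Dsin2 (a^-1 * complex.Im (Psi xi)).
move: (cos _) (sin _) => c s cs; rewrite !ler_norml; nra.
Qed.

(** With Psi = a + i b the mean is 1 - e ^ (t a) cos (t b), that is (1 - e ^ (t a)) + e ^ (t a) (1 -
    cos (t b)). As a <= 0, this is at most - t a + t |b|, and both terms are at most t |Psi|. *)
Lemma integral_one_sub_cos_le (t xi : R) : 0 <= t ->
  (\int[P]_w (1 - cos (xi * L t w))%:E <=
    (2 * t * ComplexField.Normc.normc (Psi xi))%:E)%E.
Proof.
move=> t0.
have mc := measurable_cosM (L t) xi.
have ic := integrable_bounded1 mc (fun w => cos_max _).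
under eq_integral do rewrite EFinB.
rewrite integralB_EFin//; last exact: finite_measure_integrable_cst.
rewrite (_ : \int[P]_w 1 = 1)%E; last first.
  by rewrite integral_cst// mul1e; exact: probability_setT.
have := char_exponent_cos xi t0; rewrite unlock => E.
rewrite -(fineK (integrable_fin_num _ ic))// E -EFinB lee_fin.
have a0 := char_exponent_Re_le0 xi.
have := norm_Re_le_normc (Psi xi); rewrite (ler0_norm a0).
have := norm_Im_le_normc (Psi xi).
have := one_sub_cos_le (t * complex.Im (Psi xi)); rewrite normrM (ger0_norm t0).
have := cos_le1 (t * complex.Im (Psi xi)).
have := expR_ge1Dx (t * complex.Re (Psi xi)).
have : expR (t * complex.Re (Psi xi)) <= 1 by rewrite -expR0 ler_expR mulr_ge0_le0.
have := expR_gt0 (t * complex.Re (Psi xi)).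
move: (expR _) (cos _) a0 => e c; move: (complex.Re _) `|complex.Im _| (ComplexField.Normc.normc _).
move=> a b n a0 e0 e1 ea c1 cb bn an.
have : t * b <= t * n by rewrite ler_wpM2l.
have : t * - a <= t * n by rewrite ler_wpM2l.
nra.
Qed.

End exponent.
End char_exponent.

(** * Tail comparison, continuity at time 0 and independence *)

(** Layer-cake formula: the mean of a nonnegative variable is the integral of its tail probabilities
    over r >= 0. *)
Lemma le_expectation_tail d (T : measurableType d) (R : realType)
    (P : probability T R) (c : R) (f g : T -> R) :
  measurable_fun setT f -> measurable_fun setT g ->
  (forall w, 0 <= f w) -> (forall w, 0 <= g w) -> 0 <= c ->
  (forall r, P [set w | (r < f w)%R] <= c%:E * P [set w | (r < g w)%R])%E ->
  (\int[P]_w (f w)%:E <= c%:E * \int[P]_w (g w)%:E)%E.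
Proof.
move=> mf mg f0 g0 c0 fg.
pose mf' := isMeasurableFun.Build _ _ T R f mf.
pose mg' := isMeasurableFun.Build _ _ T R g mg.
pose F : {RV P >-> R} := HB.pack f mf'.
pose G : {RV P >-> R} := HB.pack g mg'.
have cE (X : {RV P >-> R}) r : ccdf X r = P [set w | r < X w].
  by congr (P _); apply/seteqP; split=> w /=; rewrite in_itv/= andbT.
have := @ge0_expectation_ccdf _ _ _ _ F f0; have := @ge0_expectation_ccdf _ _ _ _ G g0.
rewrite !expectation_def => -> ->.
rewrite -ge0_integralZl//; last first.
  by apply: measurable_funTS; exact: ccdf_measurable.
apply: ge0_le_integral => //.
- by apply: measurable_funTS; exact: ccdf_measurable.
- apply: emeasurable_funM => //.
  by apply: measurable_funTS; exact: ccdf_measurable.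
- by move=> r _; rewrite !cE.
Qed.

Lemma eq_ae_measure d (T : measurableType d) (R : realType)
    (mu : {measure set T -> \bar R}) (A B : set T) :
  measurable A -> measurable B -> {ae mu, forall w, A w <-> B w} -> mu A = mu B.
Proof.
move=> mA mB AB.
rewrite -[A]setIT -[B]setIT -!integral_indic//.
apply: ae_eq_integral => //; try exact/measurable_EFinP.
apply: filterS AB => w AB _; congr (_%:E); rewrite !indicE.
by congr (nat_of_bool _)%:R; apply/idP/idP; rewrite !inE => /AB.
Qed.

Section levy.
Context d (T : measurableType d) (R : realType) (P : probability T R).
Variable L : R -> {RV P >-> R}.
Hypothesis levyL : levy_process L.

Lemma measurable_levy_ge (t r : R) : measurable [set w | r <= `|L t w|].
Proof.
have mLt : measurable_fun setT (fun w => `|L t w|).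
  by apply: measurableT_comp => //; exact: measurable_funPT.
by rewrite -[X in measurable X]setTI; apply: measurable_fun_le.
Qed.

(** Along any sequence of positive times tending to 0, right continuity and L_0 = 0 make the
    indicators of the events vanish eventually, almost surely; dominated convergence by the constant
    1 concludes. *)
Lemma levy_cvg_probability (r e : R) : 0 < r -> 0 < e ->
  \forall t \near 0^'+, (P [set w | (r <= `|L t w|)%R] <= e%:E)%E.
Proof.
move=> r0 e0.
have [L0 _ _ cadL] := levyL.
pose A t := [set w | r <= `|L t w|].
pose F (t : R) := fine (P (A t)).
suff : F t @[t --> 0^'+] --> (0 : R).
  move/cvgrPdist_le => /(_ _ e0); apply: filterS => t.
  rewrite sub0r normrN => /(le_trans (ler_norm _)).
  by rewrite -lee_fin fineK// fin_num_measure//; exact: measurable_levy_ge.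
apply/cvg_at_rightP => u [u0 ucvg].
have [||||| _ _ H] := @dominated_convergence _ T R P setT measurableT
  (fun n w => (\1_(A (u n)) w)%:E) (cst 0%E) (cst 1%E).
- by move=> n; apply/measurable_EFinP; apply: measurable_indic; exact: measurable_levy_ge.
- exact: measurable_cst.
- apply: filterS2 L0 cadL => w L0w [/(_ 0 (lexx _)) + _] _.
  rewrite L0w => /cvg_at_rightP/(_ u (conj u0 ucvg))/cvgrPdist_lt/(_ _ r0) Hn.
  apply: cvg_near_cst; apply: filterS Hn => n.
  by rewrite sub0r normrN indicE => Ln; rewrite memNset//= /A/= leNgt Ln.
- exact: finite_measure_integrable_cst.
- apply: aeW => w n _ /=; rewrite indicE.
  by case: (_ \in _); rewrite ?normr1 ?normr0 lee_fin.
apply: (@fine_cvg _ _ _ _ (fun n => P (A (u n))) 0).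
rewrite integral0 in H; apply: cvg_trans H.
by apply: near_eq_cvg; near=> n; rewrite /= integral_indic ?setIT//; exact: measurable_levy_ge.
Unshelve. all: by end_near. Qed.

(** The increments over [0, t] and [t, 1] are independent, and L_t - L_0 equals L_t almost
    surely. *)
Lemma levy_independent (t : R) (A B : set R) : 0 < t < 1 ->
  measurable A -> measurable B ->
  P ((L t @^-1` A) `&` [set w | B (L 1 w - L t w)]) =
  (P (L t @^-1` A) * P [set w | B (L 1 w - L t w)%R])%E.
Proof.
move=> /andP[t0 t1] mA mB.
have [L0 indL _ _] := levyL.
(* [independent_increments] asks for an infinite increasing sequence of times. It starts 0, t, 1 and
   continues along the integers. *)
pose u (i : nat) : R := match i with 0%N => 0 | 1%N => t | k.+2 => k.+1%:R end.
have uS i : u i < u i.+1.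
  by case: i => [|[|i]]//=; rewrite ltr_nat.
have mD s s' (C : set R) : measurable C -> measurable [set w | C (L s w - L s' w)].
  move=> mC; rewrite -[X in measurable X]setTI.
  apply: (measurable_funB (f := L s) (g := L s')) => //; exact: measurable_funPT.
have mLA : measurable (L t @^-1` A).
  by rewrite -[X in measurable X]setTI; exact: measurable_funPT.
have := @indL 2 u (lexx _) uS (fun i => if i == ord0 then A else B).
rewrite !big_ord_recl big_ord0 mule1/= => H.
have eqA : {ae P, forall w, A (L t w) <-> A (L t w - L 0 w)}.
  by apply: filterS L0 => w ->; rewrite subr0.
rewrite (@eq_ae_measure _ _ _ P _ [set w | A (L t w - L 0 w)] mLA (mD _ _ _ mA))//.
rewrite (@eq_ae_measure _ _ _ P
  (L t @^-1` A `&` [set w | B (L 1 w - L t w)])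
  ([set w | A (L t w - L 0 w)] `&` [set w | B (L 1 w - L t w)])).
- rewrite -[RHS]H; last by move=> i; case: ifP.
  congr (P _); apply/seteqP; split=> [w [/= Aw Bw] i _|w /= H'].
    by case: i => [[|[|i]]]//= ?.
  by split; [exact: (H' ord0)|exact: (H' (lift ord0 ord0))].
- exact: measurableI (mD _ _ _ mB).
- exact: measurableI (mD _ _ _ mA) (mD _ _ _ mB).
- by apply: filterS eqA => w /= ->.
Qed.

End levy.

(** * Logarithmic moments, uniformly for small times *)

Lemma measurable_superlevel d (T : measurableType d) (R : realType) (f : T -> R)
    (r : R) : measurable_fun setT f -> measurable [set w | r < f w].
Proof.
move=> mf; have := mf measurableT `]r, +oo[%classic (measurable_itv _).
by rewrite setTI; congr (measurable _); apply/seteqP; split=> w /=;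
  rewrite in_itv/= andbT.
Qed.

Lemma ln1D_ge0 (R : realType) (x : R) : 0 <= ln (1 + `|x|).
Proof. by rewrite ln_ge0// lerDl. Qed.

Lemma measurable_ln1D d (T : measurableType d) (R : realType) (f : T -> R) :
  measurable_fun setT f ->
  measurable_fun setT (fun w => ln (1 + `|f w|)).
Proof.
move=> mf; apply: (@measurableT_comp _ _ _ _ _ _ (@ln R) _ (fun w => 1 + `|f w|)).
  exact: measurable_ln.
by apply: measurable_funD => //; exact: measurableT_comp.
Qed.

Section log_moment.
Context d (T : measurableType d) (R : realType) (P : probability T R).
Implicit Types X : {RV P >-> R}.

Lemma log_moment_fin X (p : R) : 0 < p ->
  ('E_P[fun w => (`|X w| `^ p)%R] < +oo)%E ->
  (\int[P]_w (ln (1 + `|X w|))%:E < +oo)%E.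
Proof.
rewrite unlock => p0 Ep.
have mX : measurable_fun setT X by exact: measurable_funPT.
have mp : measurable_fun setT (fun w => `|X w| `^ p).
  apply: (@measurableT_comp _ _ _ _ _ _ (fun x => x `^ p) _ (fun w => `|X w|)).
    exact: measurable_powR.
  exact: measurableT_comp.
have V0 : 0 <= p^-1 by rewrite invr_ge0 ltW.
have ln2 : 0 < ln 2 :> R by apply: ln_gt0; lra.
apply: (@le_lt_trans _ _ (\int[P]_w ((ln 2)%:E + (p^-1)%:E * (`|X w| `^ p)%:E))%E).
  apply: ge0_le_integral => //.
  - by move=> w _; rewrite lee_fin ln1D_ge0.
  - by apply/measurable_EFinP; exact: measurable_ln1D.
  - apply: emeasurable_funD => //; apply: emeasurable_funM => //.
    exact/measurable_EFinP.
  - move=> w _; rewrite -EFinM -EFinD lee_fin mulrC; exact: ln1D_le_powR.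
rewrite ge0_integralD//; last 3 first.
- by move=> w _; rewrite lee_fin ltW.
- by move=> w _; rewrite mule_ge0// lee_fin powR_ge0.
- by apply: emeasurable_funM => //; exact/measurable_EFinP.
rewrite integral_cst// ge0_integralZl//; last first.
  exact/measurable_EFinP.
rewrite lte_add_pinfty//; last by rewrite lte_mul_pinfty.
by rewrite lte_mul_pinfty// ?lee_fin ?ltW// (le_lt_trans (probability_le1 _ _)) ?ltry.
Qed.

(** Markov's inequality for the increasing function ln (1 + |x|). *)
Lemma log_moment_tight X (e : R) : 0 < e ->
  (\int[P]_w (ln (1 + `|X w|))%:E < +oo)%E ->
  exists2 K : R, 0 < K & (P [set w | (K <= `|X w|)%R] <= e%:E)%E.
Proof.
move=> e0 Xfin; set J := (\int[P]_w _)%E in Xfin.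
have J0 : (0 <= J)%E by apply: integral_ge0 => w _; rewrite lee_fin ln1D_ge0.
have Jf : J \is a fin_num by rewrite ge0_fin_numE.
(* This choice gives ln (1 + K) > J / e, so Markov's bound J / ln (1 + K) is at most [e]. *)
pose K := expR (fine J / e).
have K0 : 0 < K by exact: expR_gt0.
exists K => //.
have lnK : fine J / e < ln (1 + K).
  by rewrite -[ltLHS]expRK -/K ltr_ln ?posrE//; lra.
have mA : measurable [set w | (K <= `|X w|)%R].
  rewrite -[X in measurable X]setTI; apply: measurable_fun_le => //.
  by apply: measurableT_comp => //; exact: measurable_funPT.
have : ((ln (1 + K))%:E * P [set w | (K <= `|X w|)%R] <= J)%E.
  have := @markov _ _ _ P X (fun x => ln (1 + `|x|)) K K0
    (measurable_ln1D (@measurable_id _ _ _)) (fun x _ => ln1D_ge0 x).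
  rewrite (gtr0_norm K0) unlock.
  under eq_integral do rewrite /= normr_id.
  under eq_set do rewrite abse_EFin lee_fin.
  apply => x y; rewrite !nnegrE => x0 y0 xy.
  by rewrite ler_ln ?posrE ?ger0_norm//; lra.
rewrite -(fineK Jf) -(fineK (fin_num_measure P _ mA)) -EFinM !lee_fin.
move: (fine (P _)) => q; move: lnK; rewrite ltr_pdivrMr//.
have : 0 <= fine J by exact: fine_ge0.
move: (fine J) (ln _) => j l j0 jl lq.
rewrite leNgt; apply/negP => eq; nra.
Qed.
End log_moment.

Section levy.
Context d (T : measurableType d) (R : realType) (P : probability T R).
Variable L : R -> {RV P >-> R}.
Hypothesis levyL : levy_process L.

(* L_1 - L_t is independent of L_t and, with probability at least 1/2, bounded
   by a constant c uniformly in small t; there ln(1 + |L_t|) is at most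
   ln(1 + |L_1|) + ln(1 + c). *)
Lemma levy_log_moment_bounded :
  (\int[P]_w (ln (1 + `|L 1 w|))%:E < +oo)%E ->
  exists C : R, \forall t \near 0^'+, (\int[P]_w (ln (1 + `|L t w|))%:E <= C%:E)%E.
Proof.
move=> L1fin.
have q0 : 0 < 4^-1 :> R by rewrite invr_gt0.
have half (x : R) : 1 - x <= 2^-1 -> 2^-1 <= x by lra.
have quarters : 4^-1 + 4^-1 <= 2^-1 :> R by lra.
have [K K0 PK] := log_moment_tight q0 L1fin.
pose c := ln (1 + (K + 1)).
have c0 : 0 <= c by rewrite ln_ge0// lerDl addr_ge0// ltW.
pose g w := ln (1 + `|L 1 w|) + c.
have mg : measurable_fun setT g.
  by apply: measurable_funD => //; apply: measurable_ln1D; exact: measurable_funPT.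
have g0 w : 0 <= g w by rewrite addr_ge0// ln1D_ge0.
(* The factor 2 is the inverse of the lower bound 1/2 on the probability of the event [E] below. *)
exists (2 * fine (\int[P]_w (g w)%:E)%E).
near=> t.
have Lt1 : (P [set w | (1 <= `|L t w|)%R] <= (4^-1)%:E)%E.
  by near: t; apply: levy_cvg_probability.
have t0 : 0 < t by near: t; exact: nbhs_right_gt.
have t1 : t < 1 by near: t; exact: nbhs_right_lt.
pose B : set R := [set z | `|z| <= K + 1].
have mB : measurable B.
  by rewrite -[B]setTI; apply: measurable_fun_le => //; exact: measurableT_comp.
pose E := [set w | B (L 1 w - L t w)].
have mE : measurable E.
  rewrite -[X in measurable X]setTI.
  apply: (measurable_funB (f := L 1) (g := L t)) => //; exact: measurable_funPT.
(* Outside [E], |L_1| >= K or |L_t| >= 1, and each of these events has probability at most 1/4. *)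
have PE : ((2^-1)%:E <= P E)%E.
  have : (P (~` E) <= (2^-1)%:E)%E.
    apply: (@le_trans _ _ (P ([set w | (K <= `|L 1 w|)%R] `|` [set w | (1 <= `|L t w|)%R]))).
      apply: le_measure; rewrite ?inE.
      - exact: measurableC.
      - by apply: measurableU; exact: measurable_levy_ge.
      - move=> w; rewrite /E/B/= => /negP; rewrite -ltNge => Ew.
        have := ler_normB (L 1 w) (L t w).
        have [?|L1w] := leP K `|L 1 w|; first by left.
        have [?|Ltw] := leP 1 `|L t w|; first by right.
        by move=> /(lt_le_trans Ew); rewrite ltNge ltW// ltrD.
    apply: le_trans (measureU2 _ _ _) _; [exact: measurable_levy_ge..|].
    apply: le_trans (leeD PK Lt1) _.
    by rewrite -EFinD lee_fin.
  rewrite probability_setC// -(fineK (fin_num_measure P _ mE)) -EFinB !lee_fin; exact: half.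
have gfin : (\int[P]_w (g w)%:E)%E \is a fin_num.
  rewrite ge0_fin_numE; last by apply: integral_ge0 => w _; rewrite lee_fin.
  under eq_integral do rewrite EFinD.
  rewrite ge0_integralD//; last 2 first.
  - by move=> w _; rewrite lee_fin ln1D_ge0.
  - by apply/measurable_EFinP; apply: measurable_ln1D; exact: measurable_funPT.
  rewrite lte_add_pinfty// integral_cst//.
  by rewrite lte_mul_pinfty// ?lee_fin// (le_lt_trans (probability_le1 _ _)) ?ltry.
rewrite EFinM fineK//; apply: le_expectation_tail => //.
- by apply: measurable_ln1D; exact: measurable_funPT.
- by move=> w; exact: ln1D_ge0.
move=> r.
pose A : set R := [set x | r < ln (1 + `|x|)].
have mA : measurable A.
  apply: measurable_superlevel. apply: measurable_ln1D; exact: (@measurable_id _ _ _).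
have := levy_independent levyL (_ : 0 < t < 1) mA mB; rewrite t0 t1 => /(_ erefl).
rewrite -/E => indep.
(* On [E], subadditivity bounds ln (1 + |L_t|) by [g]. Hence {L_t in A} and [E] together force r <
   g, and by independence their joint probability is a product. *)
have : (P (L t @^-1` A) * (2^-1)%:E <= P [set w | (r < g w)%R])%E.
  apply: (@le_trans _ _ (P (L t @^-1` A) * P E)%E).
    by rewrite lee_wpmul2l.
  rewrite -indep; apply: le_measure; rewrite ?inE.
  - apply: measurableI => //; rewrite -[X in measurable X]setTI.
    exact: measurable_funPT.
  - exact: measurable_superlevel.
  - move=> w [/= Aw Ew]; apply: (lt_le_trans Aw).
    apply: (le_trans (ln1D_subadd _ (L 1 w))).
    by rewrite lerD2l ler_ln ?posrE ?lerD2l// ltr_wpDr// ?addr_ge0// ltW.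
move=> /(lee_wpmul2l (_ : 0 <= 2%:E)%E); rewrite lee_fin => /(_ (ler0n _ _)).
by rewrite muleC -muleA -EFinM mulVf// mule1.
Unshelve. all: end_near. Qed.
End levy.

(** * Dyadic scales and the logarithmic moment of the rescaled process *)

(** [N] is taken minimal. The scales cover [0, r], yet all those summed stay at most r, so that with
    r = 1 / M the frequencies 1 / (s 2 ^ j) remain above [M], where the bound on Psi holds. *)
Lemma dyadic_scale (R : realType) (s r : R) : 0 < s ->
  exists2 N : nat, r < s * 2 ^+ N & forall j, (j < N)%N -> s * 2 ^+ j <= r.
Proof.
move=> s0.
have exN : exists N : nat, r < s * 2 ^+ N.
  exists (Num.bound `|r / s|).
  rewrite mulrC -ltr_pdivrMr// (le_lt_trans (ler_norm _))//.
  apply: (lt_le_trans (archi_boundP (normr_ge0 _))).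
  by rewrite -natrX ler_nat; apply: ltnW; exact: ltn_expl.
case: (ex_minnP exN) => N rN minN; exists N => // j jN.
by rewrite leNgt; apply/negP => /minN; rewrite leqNgt jN.
Qed.

(** As the infimum is below [q], some admissible exponent is too, and a ratio tending to 0 is
    eventually below 1. *)
Lemma blumenthal_getoor_bound (R : realType) (Psi : R -> R[i]) (beta q : R) :
  blumenthal_getoor_index Psi = beta%:E -> beta < q ->
  exists p M : R, [/\ 0 < p < q, 0 < M & forall xi, M <= xi ->
    ComplexField.Normc.normc (Psi xi) <= xi `^ p].
Proof.
move=> betaE; rewrite -lte_fin -betaE => /ereal_inf_lt[_ [p [p0 + _] <-]].
rewrite lte_fin => /cvgrPdist_lt/(_ 1 ltr01)[M [_ HM]] pq.
(* This threshold is positive and strictly beyond [M]. *)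
exists p, (Num.max M 0 + 1); split.
- by rewrite p0.
- by rewrite ltr_wpDl// le_max lexx orbT.
move=> xi Mxi.
have xi0 : 0 < xi.
  by apply: lt_le_trans Mxi; rewrite ltr_wpDl// le_max lexx orbT.
have /HM : M < xi by apply: lt_le_trans Mxi; rewrite ltr_pwDr// le_max lexx.
rewrite /= sub0r normrN => /ltW /(le_trans (ler_norm _)).
by rewrite gtr0_norm// ler_pdivrMr ?powR_gt0// mul1r.
Qed.

Section entropy_small_time.
Context d (T : measurableType d) (R : realType) (P : probability T R).
Variables (L : R -> {RV P >-> R}) (Psi : R -> R[i]).
Hypotheses (levyL : levy_process L) (LPsi : is_char_exponent L Psi).

(** For s = t ^ (1 / q) and xi = 1 / (s 2 ^ j), t xi ^ q = 2 ^ (- j q), in which t cancels. The form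
    of the bound anticipates the weight base a = 2 ^ (q / 2), since 2 ^ (- q) = a ^ (-2). *)
Lemma integral_one_sub_cos_dyadic_le (q M t : R) (j : nat) :
  0 < q -> 0 < M -> 0 < t ->
  (forall xi, M <= xi -> ComplexField.Normc.normc (Psi xi) <= xi `^ q) ->
  t `^ q^-1 * 2 ^+ j <= M^-1 ->
  (\int[P]_w (1 - cos ((t `^ q^-1 * 2 ^+ j)^-1 * L t w))%:E <=
    (2 * ((2 `^ (q / 2)) ^- 2) ^+ j)%:E)%E.
Proof.
move=> q0 M0 t0 HM jM.
have s0 : 0 < t `^ q^-1 * 2 ^+ j by rewrite mulr_gt0 ?powR_gt0 ?exprn_gt0.
apply: (le_trans (integral_one_sub_cos_le LPsi _ (ltW t0))).
rewrite lee_fin -mulrA ler_pM2l//.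
apply: (@le_trans _ _ (t * (t `^ q^-1 * 2 ^+ j)^-1 `^ q)).
  rewrite ler_wpM2l ?(ltW t0)// HM//.
  by rewrite -[M]invrK lef_pV2 ?posrE ?invr_gt0.
have E : 2 `^ q = (2 `^ (q / 2)) ^+ 2 :> R.
  by rewrite -powR_mulrn ?powR_ge0// -powRrM divfK.
rewrite -(powR_inv1 (ltW s0)) powRAC powR_inv1 ?powR_ge0// powRM ?powR_ge0//.
rewrite -powRrM mulVf ?gt_eqF// powRr1 ?(ltW t0)// -(powR_mulrn j)// powRAC.
by rewrite powR_mulrn ?powR_ge0// E invfM mulrA mulfV ?gt_eqF// mul1r exprVn.
Qed.

Lemma log_scale_moment_le (q M t C a dl : R) : a = 2 `^ (q / 2) ->
  0 < q -> 0 < M -> 0 < t <= 1 ->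
  (forall xi, M <= xi -> ComplexField.Normc.normc (Psi xi) <= xi `^ q) ->
  (\int[P]_w (ln (1 + `|L t w|))%:E <= C%:E)%E ->
  (P [set w | (M^-1 <= `|L t w|)%R] <= dl%:E)%E ->
  (\int[P]_w (ln (1 + `|L t w| / t `^ q^-1))%:E <=
    (ln 2 + ln 2 / ln a * a ^+ 2 / (1 - cos 1) * (2 * (1 - a^-1)^-1)
     + q^-1 * ln t^-1 * dl + C)%:E)%E.
Proof.
move=> aE q0 M0 /andP[t0 t1] HM HC Hdl.
have lns : ln (t `^ q^-1)^-1 = q^-1 * ln t^-1.
  by rewrite !lnV ?posrE ?powR_gt0// ln_powR mulrN.
have lt0 : 0 <= ln t^-1 by rewrite ln_ge0// invf_ge1.
have s1 : t `^ q^-1 <= 1.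
  by rewrite -ler_ln ?posrE ?powR_gt0// ln1 -oppr_ge0 -lnV ?posrE ?powR_gt0// lns
    mulr_ge0// invr_ge0 ltW.
have I := fun j => @integral_one_sub_cos_dyadic_le q M t j q0 M0 t0 HM.
pose s := t `^ q^-1; rewrite -[t `^ q^-1]/s in lns s1 *; rewrite -/s -aE in I.
have s0 : 0 < s by exact: powR_gt0.
have a1 : 1 < a.
  have -> : 1 = 1 `^ (q / 2) :> R by rewrite powR1.
  by rewrite aE gt0_ltr_powR ?nnegrE ?divr_gt0// ltr1n.
have a0 : 0 < a by exact: lt_trans a1.
have [N rN jN] := dyadic_scale M^-1 s0.
set D := ln 2 / ln a * a ^+ 2 / (1 - cos 1).
have D0 : 0 <= D.
  rewrite divr_ge0 ?subr_ge0 ?cos_le1// mulr_ge0 ?exprn_ge0 ?(ltW a0)//.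
  by rewrite divr_ge0 ?ln_ge0 ?(ltW a1)// lerDl.
pose A := [set w | (M^-1 <= `|L t w|)%R].
have mA : measurable A by exact: measurable_levy_ge.
pose S (y : R) := \sum_(j < N) a ^+ j * (1 - cos ((s * 2 ^+ j)^-1 * y)).
have S0 y : 0 <= S y.
  by apply: sumr_ge0 => j _; rewrite mulr_ge0 ?exprn_ge0 ?subr_ge0 ?cos_le1 ?ltW.
have mcos (j : nat) : measurable_fun setT (fun w => a ^+ j * (1 - cos ((s * 2 ^+ j)^-1 * L t w))).
  by apply: measurable_funM => //; apply: measurable_funB => //; exact: measurable_cosM.
have mS : measurable_fun setT (fun w => S (L t w)).
  exact: measurable_sum.
have mL : measurable_fun setT (L t) by exact: measurable_funPT.
(* The weight a ^ j against the mean 2 a ^ (- 2 j) leaves 2 a ^ (- j), a geometric series bounded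
   independently of [N] and [t]. *)
have IS : (\int[P]_w (S (L t w))%:E <= (2 * (1 - a^-1)^-1)%:E)%E.
  under eq_integral do rewrite -sumEFin.
  rewrite ge0_integral_sum//; last 2 first.
  - by move=> j; apply/measurable_EFinP; exact: mcos.
  - by move=> j w _; rewrite lee_fin mulr_ge0 ?exprn_ge0 ?subr_ge0 ?cos_le1 ?ltW.
  apply: (@le_trans _ _ (\sum_(j < N) (2 * a^-1 ^+ j)%:E)%E).
    apply: lee_sum => j _.
    under eq_integral do rewrite EFinM.
    rewrite ge0_integralZl//; last 2 first.
    - by apply/measurable_EFinP; apply: measurable_funB => //; exact: measurable_cosM.
    - by rewrite lee_fin exprn_ge0// ltW.
    apply: le_trans (lee_wpmul2l _ (I j (jN j (ltn_ord j)))) _.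
      by rewrite lee_fin exprn_ge0// ltW.
    rewrite -EFinM lee_fin mulrCA ler_pM2l// -exprMn.
    by rewrite [X in X ^+ _](_ : _ = a^-1)// expr2 invfM mulrA mulfV ?mul1r ?gt_eqF.
  rewrite sumEFin lee_fin -mulr_sumr ler_pM2l//.
  have aV1 : a^-1 < 1 by rewrite invf_lt1.
  rewrite -[leRHS]mul1r ler_pdivlMr ?subr_gt0// mulrC -opprB mulNr -subrX1 opprB.
  by rewrite gerBl exprn_ge0// invr_ge0 ltW.
(* Below 1 / M the dyadic sum dominates; on [A] the bound is ln (1 / s) + ln (1 + |L_t|), where ln
   (1 / s) = q^-1 ln (1 / t). All terms are nonnegative, so their sum covers both cases. *)
apply: (@le_trans _ _ (\int[P]_w ((ln 2)%:E + (D%:E * (S (L t w))%:E +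
    ((q^-1 * ln t^-1)%:E * (\1_A w)%:E + (ln (1 + `|L t w|))%:E))))%E).
  apply: ge0_le_integral => //.
  - by move=> w _; rewrite lee_fin ln_ge0// lerDl divr_ge0// ltW.
  - apply/measurable_EFinP.
    rewrite (_ : (fun w => ln _) = fun w => ln (1 + `|s^-1 * L t w|)).
      by apply: measurable_ln1D; exact: measurable_funM.
    apply/funext => w; rewrite normrM mulrC gtr0_norm// invr_gt0//.
  - apply: emeasurable_funD => //; apply: emeasurable_funD.
      by apply: emeasurable_funM => //; exact/measurable_EFinP.
    apply: emeasurable_funD.
      by apply: emeasurable_funM => //; exact/measurable_EFinP/measurable_indic.
    by apply/measurable_EFinP; exact: measurable_ln1D.
  - move=> w _; rewrite -!EFinM -!EFinD lee_fin.
    have ln1 := ln1D_ge0 (L t w).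
    have [Lr|Lr] := ltP `|L t w| M^-1.
      have -> : \1_A w = 0 :> R by rewrite indicE memNset//= /A/= leNgt Lr.
      have := @ln_le_dyadic_cos R a s (L t w) N a1 s0 (lt_trans Lr rN).
      rewrite -/D -/(S _); lra.
    have -> : \1_A w = 1 :> R by rewrite indicE mem_set.
    have := @ln1D_scale R s `|L t w|; rewrite s0 s1 normr_ge0 lns => /(_ erefl erefl).
    have : 0 <= D * S (L t w) by rewrite mulr_ge0.
    have : 0 <= ln 2 :> R by rewrite ln_ge0// lerDl.
    lra.
have mDS : measurable_fun setT (fun w => D%:E * (S (L t w))%:E)%E.
  by apply: emeasurable_funM => //; exact/measurable_EFinP.
have mqA : measurable_fun setT (fun w => (q^-1 * ln t^-1)%:E * (\1_A w : R)%:E)%E.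
  by apply: emeasurable_funM => //; exact/measurable_EFinP/measurable_indic.
have mln : measurable_fun setT (fun w => (ln (1 + `|L t w|))%:E).
  by apply/measurable_EFinP; exact: measurable_ln1D.
have qt0 : 0 <= q^-1 * ln t^-1 by rewrite mulr_ge0 ?invr_ge0 ?(ltW q0).
have ln2 : 0 <= ln 2 :> R by rewrite ln_ge0// lerDl.
have i0 w : (0 <= (q^-1 * ln t^-1)%:E * (\1_A w : R)%:E)%E.
  by rewrite mule_ge0 ?lee_fin ?indicE.
have S0' w : (0 <= D%:E * (S (L t w))%:E)%E by rewrite mule_ge0 ?lee_fin.
have g0 w : (0 <= (ln (1 + `|L t w|))%:E)%E by rewrite lee_fin ln1D_ge0.
rewrite ge0_integralD//; last 2 first.
- by move=> w _; rewrite !adde_ge0.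
- by apply: emeasurable_funD => //; apply: emeasurable_funD.
rewrite ge0_integralD//; last 2 first.
- by move=> w _; rewrite adde_ge0.
- by apply: emeasurable_funD.
rewrite ge0_integralD//.
rewrite ge0_integralZl//; last 2 first.
- exact/measurable_EFinP.
- by move=> w _; rewrite lee_fin.
rewrite ge0_integralZl//; last by apply/measurable_EFinP/measurable_indic.
rewrite integral_indic// setIT integral_cst// !EFinD -!addeA.
apply: leeD.
  apply: (@le_trans _ _ ((ln 2)%:E * 1)%E); last by rewrite mule1.
  by apply: lee_wpmul2l => //; exact: probability_le1.
apply: leeD; first by rewrite (EFinM D) lee_wpmul2l.
by apply: leeD => //; rewrite (EFinM (_ * _)) lee_wpmul2l.
Qed.
End entropy_small_time.

(** * The entropy rate at small times *)

Section entropy_rate.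
Context d (T : measurableType d) (R : realType) (P : probability T R).
Variables (L : R -> {RV P >-> R}) (Psi : R -> R[i]) (beta p : R).
Hypotheses (levyL : levy_process L) (LPsi : is_char_exponent L Psi)
  (Lac : forall t : R, 0 < t -> absolutely_continuous (L t))
  (betaE : blumenthal_getoor_index Psi = beta%:E)
  (p0 : 0 < p) (Lp : ('E_P[fun w => (`|L 1 w| `^ p)%R] < +oo)%E).

(** The scale s = t ^ (1 / q) contributes the main term - q^-1 ln (1 / t); everything else must fit
    into e ln (1 / t). *)
Lemma entropy_small_time_le (q M e : R) : 0 < q -> 0 < M -> 0 < e ->
  (forall xi, M <= xi -> ComplexField.Normc.normc (Psi xi) <= xi `^ q) ->
  \forall t \near 0^'+,
    (differential_entropy (L t) <= ((e - q^-1) * ln t^-1)%:E)%E.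
Proof.
move=> q0 M0 e0 HM.
have [C HC] := levy_log_moment_bounded levyL (log_moment_fin p0 Lp).
pose a : R := 2 `^ (q / 2).
pose A := ln 2 + ln 2 / ln a * a ^+ 2 / (1 - cos 1) * (2 * (1 - a^-1)^-1).
(* Once ln (1 / t) >= B, the constants pi + 2 A + 2 C use at most half of e ln (1 / t). *)
pose B := (pi + 2 * A + 2 * C) / (e / 2).
(* A tail probability of at most e q / 4 makes the term 2 q^-1 ln (1 / t) dl use the other half. *)
have dl0 : 0 < e * q / 4 by rewrite divr_gt0// mulr_gt0.
have MV : 0 < M^-1 by rewrite invr_gt0.
have final l : B <= l ->
    - (q^-1 * l) + pi + 2 * (A + q^-1 * l * (e * q / 4) + C) <= (e - q^-1) * l.
  rewrite ler_pdivrMr ?divr_gt0//.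
  have -> : q^-1 * l * (e * q / 4) = l * (e / 4) by field; rewrite gt_eqF.
  lra.
near=> t.
have t0 : 0 < t by near: t; exact: nbhs_right_gt.
have t1 : t < 1 by near: t; exact: nbhs_right_lt.
have tB : t < expR (- B) by near: t; apply: nbhs_right_lt; exact: expR_gt0.
have Bl : B <= ln t^-1.
  by rewrite lnV ?posrE// lerNr ltW// -[ltRHS]expRK ltr_ln ?posrE ?expR_gt0.
have Ct : (\int[P]_w (ln (1 + `|L t w|))%:E <= C%:E)%E by near: t.
have Pt : (P [set w | (M^-1 <= `|L t w|)%R] <= (e * q / 4)%:E)%E.
  by near: t; exact: levy_cvg_probability.
set s := t `^ q^-1.
have s0 : 0 < s by exact: powR_gt0.
have lns : ln s = - (q^-1 * ln t^-1) by rewrite ln_powR lnV ?posrE// mulrN opprK.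
have mL : measurable_fun setT (fun w => L t w / s).
  by apply: measurable_funM => //; exact: measurable_funPT.
have normLs w : `|L t w| / s = `|L t w / s|.
  by rewrite normrM (gtr0_norm (_ : 0 < s^-1)) ?invr_gt0.
have mls : measurable_fun setT (fun w => (ln (1 + `|L t w| / s))%:E).
  apply/measurable_EFinP; under eq_fun do rewrite normLs.
  exact: measurable_ln1D.
apply: (le_trans (differential_entropy_le s0 (Lac t0))).
have t01 : 0 < t <= 1 by rewrite t0 ltW.
have key := log_scale_moment_le LPsi (erefl a) q0 M0 t01 HM Ct Pt.
apply: (@le_trans _ _ ((ln s + pi)%:E + 2%:E * \int[P]_w (ln (1 + `|L t w| / s))%:E)%E).
  apply: leeD => //; rewrite -ge0_integralZl//.
  - apply: ge0_le_integral => //.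
    + by move=> w _; rewrite lee_fin ln_ge0// lerDl sqr_ge0.
    + apply/measurable_EFinP.
      apply: (@measurableT_comp _ _ _ _ _ _ (@ln R) _ (fun w => 1 + (L t w / s) ^+ 2)).
        exact: measurable_ln.
      by apply: measurable_funD => //; exact: measurable_funX.
    + exact: emeasurable_funM.
    + move=> w _; rewrite -EFinM lee_fin.
      by rewrite normLs ln_sqr_le.
  - by move=> w _; rewrite lee_fin ln_ge0// lerDl divr_ge0// ltW.
apply: le_trans (leeD (lexx _) (lee_wpmul2l _ key)) _; first by rewrite lee_fin.
rewrite -EFinM -EFinD lee_fin lns; exact: final.
Unshelve. all: end_near. Qed.

Lemma entropy_ratio_le (x : R) : 0 <= beta -> (- (beta%:E)^-1 < x%:E)%E ->
  \forall t \near 0^'+,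
    (differential_entropy (L t) / (ln t^-1)%:E <= x%:E)%E.
Proof.
move=> b0 bx.
(* For x >= 0 any exponent will do. For x < 0 the hypothesis says beta < 1 / (- x), and an exponent
   strictly below 1 / (- x) leaves the slack x + q^-1 > 0. *)
have [q [M [q0 M0 HM qx]]] : exists q M : R, [/\ 0 < q, 0 < M,
    (forall xi, M <= xi -> ComplexField.Normc.normc (Psi xi) <= xi `^ q)
    & 0 < x + q^-1].
  have [x0|x0] := leP 0 x.
    have [|q [M [/andP[q0 _] M0 HM]]] := blumenthal_getoor_bound (q := beta + 1) betaE.
      by rewrite ltrDl.
    by exists q, M; split => //; rewrite ltr_wpDl// invr_gt0.
  have nx : 0 < - x by rewrite oppr_gt0.
  have [|q [M [/andP[q0 qx] M0 HM]]] := blumenthal_getoor_bound (q := (- x)^-1) betaE.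
    move: b0; rewrite le_eqVlt => /predU1P[<-|b0]; first by rewrite invr_gt0.
    move: bx; rewrite inver gt_eqF// -EFinN lte_fin ltrNl => bx.
    by rewrite -[beta]invrK ltf_pV2 ?posrE ?invr_gt0.
  exists q, M; split => //.
  by rewrite -[x]opprK addrC subr_gt0 -[- x]invrK ltf_pV2 ?posrE ?invr_gt0.
(* The slack is used as [e], so that e - q^-1 = x. *)
have := entropy_small_time_le q0 M0 qx HM; rewrite addrK => H.
near=> t.
have t0 : 0 < t by near: t; exact: nbhs_right_gt.
have t1 : t < 1 by near: t; exact: nbhs_right_lt.
have l0 : 0 < ln t^-1 by rewrite ln_gt0// invf_gt1.
rewrite inver gt_eqF// muleC lee_pdivrMl// -EFinM mulrC.
by near: t.
Unshelve. all: end_near. Qed.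
End entropy_rate.

(* In \bar R the library has 0^-1 = +oo, so - beta^-1 = -oo when beta = 0. *)
Theorem theorem4p5 (d : measure_display) (T : measurableType d) (R : realType)
    (P : probability T R) (L : R -> {RV P >-> R}) (Psi : R -> R[i])
    (beta p : R) :
  levy_process L ->
  is_char_exponent L Psi ->
  sector_condition Psi ->
  (forall t : R, 0 < t -> absolutely_continuous (L t)) ->
  0 <= beta <= 2 ->
  blumenthal_getoor_index Psi = beta%:E ->
  0 < p ->
  ('E_P[fun w => (`|L 1 w| `^ p)%R] < +oo)%E ->
  (limf_esup (fun t : R => differential_entropy (L t) / (ln t^-1)%:E) 0^'+
     <= - (beta%:E)^-1)%E /\
  (beta = 0 ->
     (differential_entropy (L t) / (ln t^-1)%:E)%E @[t --> 0^'+] --> -oo%E).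
Proof.
move=> levyL LPsi _ Lac /andP[b0 _] betaE p0 Lp.
have ratio x := @entropy_ratio_le _ _ _ _ _ _ _ _ levyL LPsi Lac betaE p0 Lp x b0.
split; last first.
  move=> beta0; apply/cvgeNyPle => x; apply: ratio.
  by rewrite beta0 inver eqxx ltNyr.
have limsup x : (- (beta%:E)^-1 < x%:E)%E ->
    (limf_esup (fun t : R => differential_entropy (L t) / (ln t^-1)%:E) 0^'+
      <= x%:E)%E.
  (* The upper limit is an infimum of suprema over sets of the filter; the set where the ratio is at
     most [x] is one of them. *)
  move=> /ratio Hx; rewrite limf_esupE; apply: ereal_inf_le.
  exists (ereal_sup ((fun t : R => differential_entropy (L t) / (ln t^-1)%:E)%E
    @` [set t | (differential_entropy (L t) / (ln t^-1)%:E <= x%:E)%E])).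
    by exists [set t | (differential_entropy (L t) / (ln t^-1)%:E <= x%:E)%E].
  by apply: ge_ereal_sup => _ [t /= tx <-].
move: b0; rewrite le_eqVlt => /predU1P[b0|b0].
  rewrite -b0 inver eqxx/=.
  rewrite leeNy_eq; apply/eqP/eq_ninfty => x; apply: limsup.
  by rewrite -b0 inver eqxx ltNyr.
apply/lee_addgt0Pr => e e0.
rewrite inver gt_eqF// -EFinN -EFinD; apply: limsup.
by rewrite inver gt_eqF// -EFinN lte_fin ltrDl.
Qed.
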